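(* Let $r,s$ be positive integers, let $a_1,\dots,a_r,b_1,\dots,b_s,\alpha,\beta,z$ be as in the context, and let $w$ be the variable of the $q$-Sumudu transform $\mathfrak{S}_q$. Then $$\mathfrak{S}_q\left\{{}_rR_{s,q}(a_1,\dots,a_r;b_1,\dots,b_s;\alpha,\beta;zt);w\right\}={}_rM_{s,q}(a_1,\dots,a_r;b_1,\dots,b_s;\alpha,\beta;zw).$$
   Context: Let $q\in\mathbb{C}$, $0<|q|<1$; complex powers are formed with fixed branches. $(a;q)_0=1$, $(a;q)_n=\prod_{i=0}^{n-1}(1-aq^i)$ for $n\ge1$, $(a;q)_\infty=\prod_{i\ge0}(1-aq^i)$. $\Gamma_q(x)=\frac{(q;q)_\infty}{(q^x;q)_\infty}(1-q)^{1-x}$, with $1/\Gamma_q(x)$ read as $0$ at its poles. For complex parameters the basic functions ${}_rR_{s,q}$ and ${}_rM_{s,q}$ are $${}_rR_{s,q}(a_1,\dots,a_r;b_1,\dots,b_s;\alpha,\beta;z)=\sum_{\ell=0}^\infty\frac{z^\ell(-1)^{(1+s-r)\ell}q^{(1+s-r)\binom{\ell}{2}}}{(q;q)_\ell\,\Gamma_q(\ell\alpha+\beta)}\,\frac{\prod_{i=1}^r(a_i;q)_\ell}{\prod_{j=1}^s(b_j;q)_\ell},$$ $${}_rM_{s,q}(a_1,\dots,a_r;b_1,\dots,b_s;\alpha,\beta;z)=\sum_{\ell=0}^\infty\frac{z^\ell(-1)^{(1+s-r)\ell}q^{(1+s-r)\binom{\ell}{2}}}{\Gamma_q(\ell\alpha+\beta)}\,\frac{\prod_{i=1}^r(a_i;q)_\ell}{\prod_{j=1}^s(b_j;q)_\ell}.$$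 Standing assumption: $a_iq^\ell\ne1$ and $b_jq^\ell\neq1$ for all $i,j$ and all integers $\ell\ge0$. The Jackson integral is $\int_0^xf(t)\,\mathrm{d}_qt=(1-q)x\sum_{n\ge0}q^nf(xq^n)$. The $q$-Sumudu transform is $$\mathfrak{S}_q\{f(t);w\}=\frac{1}{(1-q)w}\int_0^wf(t)\left(\tfrac{qt}{w};q\right)_\infty\mathrm{d}_qt=\frac1{1-q}\int_0^1f(wt)\,(qt;q)_\infty\,\mathrm{d}_qt\qquad(w\in(-\tau_1,\tau_2)),$$ for the set of functions $A=\{f(t):\exists\,M,\tau_1,\tau_2>0,\ |f(t)|<M\,E_q(|t|/\tau_j),\ t\in(-1)^j\times[0,\infty)\}$, $j=1,2$, where $E_q(t)=\sum_{n\ge0}\frac{q^{n(n-1)/2}}{[n]_q!}t^n$ and $[n]_q!=\prod_{k=1}^n\frac{1-q^k}{1-q}$. *)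

(* Defs.v *)
From Stdlib Require Import Reals ZArith List FunctionalExtensionality.
From Coquelicot Require Import Coquelicot.
Open Scope C_scope.

(* Sum of a complex series, and limit of a complex sequence; they carry
   information only when the series (sequence) converges. *)
Definition CSeries (u : nat -> C) : C :=
  iota (fun l : C_CompleteNormedModule => is_series u l).

Definition CLim_seq (u : nat -> C) : C :=
  iota (fun l : C_CompleteNormedModule => filterlim u eventually (locally l)).

Lemma CSeries_unique (u : nat -> C) (l : C) :
  is_series u (l : C_CompleteNormedModule) -> CSeries u = l.
Proof. exact (iota_filterlim_locally (V := C_CompleteNormedModule) (sum_n u) l). Qed.

Lemma CLim_seq_unique (u : nat -> C) (l : C) :
  filterlim u eventually (locally (l : C_CompleteNormedModule)) -> CLim_seq u = l.
Proof. exact (iota_filterlim_locally (V := C_CompleteNormedModule) u l). Qed.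

Definition Cexp (z : C) : C := RtoC (exp (Re z)) * (cos (Im z), sin (Im z)).

Definition CpowZ (x : C) (k : Z) : C :=
  match k with
  | Z0 => 1
  | Zpos p => x ^ Pos.to_nat p
  | Zneg p => / (x ^ Pos.to_nat p)
  end.

Definition Cprod (l : list C) : C := fold_right Cmult 1 l.

Definition choose2 (n : nat) : nat := Nat.div (n * (n - 1)) 2.

Fixpoint qpoch (q a : C) (n : nat) : C :=
  match n with
  | O => 1
  | S m => qpoch q a m * (1 - a * q ^ m)
  end.

Definition qpoch_inf (q a : C) : C := CLim_seq (qpoch q a).

(* A branch of the complex powers of [q] and [1 - q] is fixed by logarithms
   [lq], [l1q] with [Cexp lq = q] and [Cexp l1q = 1 - q]: then [q^x] is
   [Cexp (x * lq)] and [(1 - q)^x] is [Cexp (x * l1q)]. *)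
Definition qGamma (q lq l1q x : C) : C :=
  qpoch_inf q q / qpoch_inf q (Cexp (x * lq)) * Cexp ((1 - x) * l1q).

(* As [/ 0 = 0], the inverse of [qGamma] vanishes at the poles of the
   q-Gamma function. *)
Lemma Cinv_qGamma_pole (q lq l1q x : C) :
  qpoch_inf q (Cexp (x * lq)) = 0 -> / qGamma q lq l1q x = 0.
Proof.
assert (H0 : / (0 : C) = 0).
{ unfold Cinv, RtoC; simpl; unfold Rdiv; f_equal; ring. }
intros H; unfold qGamma, Cdiv; rewrite H, H0.
rewrite Cmult_0_r, Cmult_0_l; exact H0.
Qed.

Definition qM_term (q lq l1q : C) (a b : list C) (alpha beta z : C)
    (l : nat) : C :=
  let k := (1 + Z.of_nat (length b) - Z.of_nat (length a))%Z in
  z ^ l * CpowZ (- (1)) (k * Z.of_nat l) * CpowZ q (k * Z.of_nat (choose2 l))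
  * / qGamma q lq l1q (RtoC (INR l) * alpha + beta)
  * (Cprod (map (fun ai => qpoch q ai l) a)
     / Cprod (map (fun bj => qpoch q bj l) b)).

Definition qR_term (q lq l1q : C) (a b : list C) (alpha beta z : C)
    (l : nat) : C :=
  qM_term q lq l1q a b alpha beta z l / qpoch q q l.

Definition qM (q lq l1q : C) (a b : list C) (alpha beta z : C) : C :=
  CSeries (qM_term q lq l1q a b alpha beta z).

Definition qR (q lq l1q : C) (a b : list C) (alpha beta z : C) : C :=
  CSeries (qR_term q lq l1q a b alpha beta z).

Definition jackson_term (q x : C) (f : C -> C) (n : nat) : C :=
  q ^ n * f (x * q ^ n).

Definition ex_jackson (q x : C) (f : C -> C) : Prop :=
  ex_series (jackson_term q x f).

Definition jackson (q x : C) (f : C -> C) : C :=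
  (1 - q) * x * CSeries (jackson_term q x f).

Definition qsumudu_integrand (q : C) (f : C -> C) (w t : C) : C :=
  f (w * t) * qpoch_inf q (q * t).

Definition ex_qsumudu (q : C) (f : C -> C) (w : C) : Prop :=
  ex_jackson q 1 (qsumudu_integrand q f w).

Definition qsumudu (q : C) (f : C -> C) (w : C) : C :=
  / (1 - q) * jackson q 1 (qsumudu_integrand q f w).

(* The form of the transform integrated up to [w], which makes sense for
   nonzero [w] only. *)
Lemma qsumuduE (q : C) (f : C -> C) (w : C) : 1 - q <> 0 -> w <> 0 ->
  qsumudu q f w
  = / ((1 - q) * w) * jackson q w (fun t => f t * qpoch_inf q (q * t / w)).
Proof.
intros Hq Hw; unfold qsumudu, jackson.
replace (jackson_term q w (fun t => f t * qpoch_inf q (q * t / w)))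
  with (jackson_term q 1 (qsumudu_integrand q f w)).
- field; split; assumption.
- apply functional_extensionality; intros n.
  unfold jackson_term, qsumudu_integrand; rewrite Cmult_1_l.
  replace (q * (w * q ^ n) / w) with (q * q ^ n) by (field; assumption).
  reflexivity.
Qed.

(* Main.v *)
Require Import Defs.
From Stdlib Require Import Reals ZArith List FunctionalExtensionality Lra Lia.
From Coquelicot Require Import Coquelicot.
Open Scope C_scope.

(** Write [d l] for the terms of the [qR] series at [z * w]; the terms of the
[qM] series are then [d l * qpoch q q l].  At the nodes [w * q ^ n] of the
Jackson integral, [qR] is the series of [d l * q ^ (n * l)], so that everything
comes down to exchanging the sums over [n] and [l] in the double series of
[qsumudu_weight q n * q ^ (n * l) * d l].

The sum over [n] is the transform of a power: it is [qpoch q q l]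
([is_series_qsumudu_pow]), the case of Euler's identity
[sum_n x ^ n / (q;q)_n = 1 / (x;q)_oo] where [x = q ^ (l + 1)].  It is obtained
here by induction on [l], from the functional equation
[(q ^ n;q)_oo = (1 - q ^ n) (q ^ (n + 1);q)_oo] alone.

For the exchange, the series of [d] is only known to converge, perhaps not
absolutely, so the row [n = 0] of the double series need not be absolutely
summable.  But what is left of the column [l] after the first [m + 1] rows is at
most [K |q| ^ m |q| ^ l] ([qsumudu_pow_tail_le]), and [d] is bounded.  Hence the
series of [d l * qpoch q q l] differs from the sum of the first [m + 1] rows,
each a convergent series, by an absolutely convergent series of sum
[O(|q| ^ m)].  For [m = 0] this gives the convergence of the [qM] series; for [m]
tending to infinity it gives that of the Jackson integral, to the same sum
([is_series_swap]). *)

(** * Series dominated by geometric ones *)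

Lemma is_series_norm_le (u : nat -> C) (v : nat -> R) (l : C) (L : R) :
  is_series u l -> is_series v L -> (forall n, Cmod (u n) <= v n)%R ->
  (Cmod l <= L)%R.
Proof.
intros Hu Hv Huv.
change (Rbar_le (Cmod l) L).
apply (filterlim_le (F := eventually) (fun n => norm (sum_n u n)) (sum_n v)).
- exists O; intros n _.
  apply Rle_trans with (1 := norm_sum_n_m u 0 n).
  apply sum_n_m_le; exact Huv.
- exact (filterlim_comp _ _ _ _ _ _ _ _ Hu (filterlim_norm (l : C_NormedModule))).
- exact Hv.
Qed.

Lemma is_series_scal_geom (K r : R) : (0 <= r < 1)%R ->
  is_series (fun n => K * r ^ n)%R (K / (1 - r))%R.
Proof.
intros Hr; apply (is_series_scal K (fun n => r ^ n)%R).
apply is_series_geom; rewrite Rabs_pos_eq; lra.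
Qed.

Lemma ex_series_geom_bound (u : nat -> C) (K r : R) : (0 <= r < 1)%R ->
  (forall n, Cmod (u n) <= K * r ^ n)%R -> ex_series u.
Proof.
intros Hr Hu.
apply (ex_series_le (V := C_CompleteNormedModule) u (fun n => K * r ^ n)%R Hu).
exists (K / (1 - r))%R; apply is_series_scal_geom, Hr.
Qed.

Lemma is_series_geom_bound (u : nat -> C) (l : C) (K r : R) : (0 <= r < 1)%R ->
  is_series u l -> (forall n, Cmod (u n) <= K * r ^ n)%R ->
  (Cmod l <= K / (1 - r))%R.
Proof.
intros Hr Hl Hu.
exact (is_series_norm_le u _ l _ Hl (is_series_scal_geom K r Hr) Hu).
Qed.

Lemma is_series_tail_geom_bound (u : nat -> C) (l : C) (K r : R) (m : nat) :
  (0 <= r < 1)%R -> is_series u l -> (forall n, Cmod (u n) <= K * r ^ n)%R ->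
  (Cmod (l - sum_n u m) <= K * r ^ S m / (1 - r))%R.
Proof.
intros Hr Hl Hu.
apply is_series_geom_bound with (u := fun k => u (S m + k)%nat); [exact Hr | |].
- apply (is_series_incr_n u (S m)); [lia |].
  simpl pred.
  change (is_series u (l - sum_n u m + sum_n u m)).
  replace (l - sum_n u m + sum_n u m) with l by ring; exact Hl.
- intros n; rewrite Rmult_assoc, <- pow_add; apply Hu.
Qed.

Lemma ex_series_terms_bounded (u : nat -> C) : ex_series u ->
  exists B, (0 <= B)%R /\ forall n, (Cmod (u n) <= B)%R.
Proof.
intros Hu.
destruct (filterlim_bounded (K := C_AbsRing) (V := C_NormedModule) (sum_n u) Hu)
  as [M HM].
exists (M + M)%R.
assert (HM0 : (0 <= M)%R) by (apply Rle_trans with (2 := HM O), norm_ge_0).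
split; [lra |]; intros [| n].
- specialize (HM O); rewrite sum_O in HM.
  change (Cmod (u O) <= M)%R in HM; lra.
- replace (u (S n)) with (sum_n u (S n) - sum_n u n).
  + apply Rle_trans with (1 := Cmod_triangle _ _); rewrite Cmod_opp.
    apply Rplus_le_compat; apply HM.
  + rewrite sum_Sn; change (sum_n u n + u (S n) - sum_n u n = u (S n)); ring.
Qed.

Lemma is_series_sum_n (h : nat -> nat -> C) (F : nat -> C) (m : nat) :
  (forall n, is_series (h n) (F n)) ->
  is_series (fun l => sum_n (fun n => h n l) m) (sum_n F m).
Proof.
intros H; induction m as [| m IH].
- rewrite sum_O; apply is_series_ext with (2 := H O).
  intros l; rewrite sum_O; reflexivity.
- rewrite sum_Sn.
  apply is_series_ext with (2 := is_series_plus _ _ _ _ IH (H (S m))).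
  intros l; rewrite sum_Sn; reflexivity.
Qed.

Lemma filterlim_geom_bound (u : nat -> C) (l : C) (K r : R) : (0 <= r < 1)%R ->
  (forall m, Cmod (u m - l) <= K * r ^ m)%R ->
  filterlim u eventually (locally (l : C_NormedModule)).
Proof.
intros Hr Hu.
apply (filterlim_locally_ball_norm (U := C_NormedModule)); intros eps.
assert (Hlim : is_lim_seq (fun m => K * r ^ m)%R 0).
{ replace (Finite 0) with (Rbar_mult K 0) by (simpl; f_equal; ring).
  apply is_lim_seq_scal_l, is_lim_seq_geom; rewrite Rabs_pos_eq; lra. }
apply is_lim_seq_spec in Hlim; destruct (Hlim eps) as [N HN].
exists N; intros m Hm; specialize (HN m Hm).
apply Rle_lt_trans with (1 := Hu m).
apply Rle_lt_trans with (2 := HN); rewrite Rminus_0_r; apply Rle_abs.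
Qed.

(** An exchange of summations for a series [d] that may converge only
conditionally: absolute summability of the double series is replaced by the
geometric decay, in [l] and in [m], of the column tails. *)
Lemma is_series_swap (d S F : nat -> C) (h : nat -> nat -> C) (K r : R) :
  (0 <= r < 1)%R -> ex_series d ->
  (forall n, is_series (fun l => d l * h n l) (F n)) ->
  (forall l m, Cmod (S l - sum_n (fun n => h n l) m) <= K * r ^ m * r ^ l)%R ->
  exists M : C, is_series (fun l => d l * S l) M /\ is_series F M.
Proof.
intros Hr Hd HF HS.
destruct (ex_series_terms_bounded d Hd) as [B [HB0 HB]].
(* What the columns still owe after rows 0 to m. *)
set (R_ m l := d l * (S l - sum_n (fun n => h n l) m)).
assert (HR : forall m l, (Cmod (R_ m l) <= B * K * r ^ m * r ^ l)%R).
{ intros m l; unfold R_; rewrite Cmod_mult.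
  replace (B * K * r ^ m * r ^ l)%R with (B * (K * r ^ m * r ^ l))%R by ring.
  apply Rmult_le_compat; auto using Cmod_ge_0. }
assert (HdS : forall m, exists Q : C, (Cmod Q <= B * K * r ^ m / (1 - r))%R /\
                  is_series (fun l => d l * S l) (Q + sum_n F m)).
{ intros m.
  destruct (ex_series_geom_bound (R_ m) _ r Hr (HR m)) as [Q HQ].
  exists Q; split; [exact (is_series_geom_bound _ _ _ r Hr HQ (HR m)) |].
  apply is_series_ext with
    (2 := is_series_plus _ _ _ _ HQ (is_series_sum_n _ F m HF)).
  intros l.
  change (R_ m l + sum_n (fun n => d l * h n l) m = d l * S l).
  replace (sum_n (fun n => d l * h n l) m) with (d l * sum_n (fun n => h n l) m)
    by (symmetry; exact (sum_n_mult_l (K := C_Ring) (d l) (fun n => h n l) m)).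
  unfold R_; ring. }
(* The sum [M] is read off at m = 0; by uniqueness of sums, the other m then
   express the same [M]. *)
destruct (HdS O) as [Q0 [_ H0]].
exists (Q0 + sum_n F O); split; [exact H0 |].
apply filterlim_geom_bound with (K := (B * K / (1 - r))%R) (r := r);
  [exact Hr |].
intros m; destruct (HdS m) as [Q [HQ Hm]].
assert (E : Q0 + sum_n F O = Q + sum_n F m).
{ rewrite <- (CSeries_unique _ _ H0); exact (CSeries_unique _ _ Hm). }
rewrite E.
change (Cmod (sum_n F m - (Q + sum_n F m)) <= B * K / (1 - r) * r ^ m)%R.
replace (sum_n F m - (Q + sum_n F m)) with (- Q) by ring.
rewrite Cmod_opp; apply Rle_trans with (1 := HQ); right; field; lra.
Qed.

(** * The infinite q-shifted factorial *)

Lemma exp_le (x y : R) : (x <= y)%R -> (exp x <= exp y)%R.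
Proof.
intros [H | ->]; [left; apply exp_increasing, H | right; reflexivity].
Qed.

(** Each factor has modulus at most [exp (|a| |q| ^ i)], and the exponents have
a geometric sum. *)
Lemma Cmod_qpoch_le (q a : C) (n : nat) : (Cmod q < 1)%R ->
  (Cmod (qpoch q a n) <= exp (Cmod a / (1 - Cmod q)))%R.
Proof.
intros Hq; pose proof (Cmod_ge_0 q) as Hq0; pose proof (Cmod_ge_0 a) as Ha0.
apply Rle_trans with (exp (Cmod a * (1 - Cmod q ^ n) / (1 - Cmod q))).
- induction n as [| n IH].
  + simpl; rewrite Cmod_1, Rminus_diag, Rmult_0_r; unfold Rdiv.
    rewrite Rmult_0_l, exp_0; lra.
  + simpl qpoch; rewrite Cmod_mult.
    replace (Cmod a * (1 - Cmod q ^ S n) / (1 - Cmod q))%R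
      with (Cmod a * (1 - Cmod q ^ n) / (1 - Cmod q) + Cmod a * Cmod q ^ n)%R
      by (simpl; field; lra).
    rewrite exp_plus.
    apply Rmult_le_compat; auto using Cmod_ge_0.
    apply Rle_trans with (1 := Cmod_triangle _ _).
    rewrite Cmod_opp, Cmod_1, Cmod_mult, Cmod_pow.
    apply exp_ineq1_le.
- assert (Hn : (0 <= Cmod q ^ n)%R) by (apply pow_le, Hq0).
  assert (Hi : (0 < / (1 - Cmod q))%R) by (apply Rinv_0_lt_compat; lra).
  apply exp_le; unfold Rdiv; apply Rmult_le_compat_r; nra.
Qed.

(** The increments [- a q ^ n (a;q)_n] of the finite products are geometrically
small, so that the product is one plus an absolutely convergent series; the same
bound controls its distance to one. *)
Lemma qpoch_cvg (q a : C) : (Cmod q < 1)%R ->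
  filterlim (qpoch q a) eventually (locally (qpoch_inf q a : C_NormedModule)) /\
  (Cmod (qpoch_inf q a - 1)
   <= exp (Cmod a / (1 - Cmod q)) * Cmod a / (1 - Cmod q))%R.
Proof.
intros Hq; pose proof (Cmod_ge_0 q) as Hq0.
assert (Hr : (0 <= Cmod q < 1)%R) by lra.
set (v n := - (qpoch q a n * (a * q ^ n))).
assert (Hv : forall n,
  (Cmod (v n) <= exp (Cmod a / (1 - Cmod q)) * Cmod a * Cmod q ^ n)%R).
{ intros n; unfold v; rewrite Cmod_opp, !Cmod_mult, Cmod_pow, <- Rmult_assoc.
  apply Rmult_le_compat_r; [apply pow_le, Hq0 |].
  apply Rmult_le_compat_r; [apply Cmod_ge_0 | apply Cmod_qpoch_le, Hq]. }
assert (Hsum : forall n, sum_n v n = qpoch q a (S n) - 1).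
{ induction n as [| n IH].
  - rewrite sum_O; unfold v; simpl; ring.
  - rewrite sum_Sn, IH.
    change (qpoch q a (S n) - 1 + v (S n) = qpoch q a (S (S n)) - 1).
    unfold v; simpl qpoch; rewrite Cpow_S; ring. }
assert (HL : exists L : C, is_series v L)
  by exact (ex_series_geom_bound v _ _ Hr Hv).
destruct HL as [L HL].
assert (Hlim : filterlim (qpoch q a) eventually
                 (locally (L + RtoC 1 : C_NormedModule))).
{ intros P HP.
  assert (H : filterlim (fun n => qpoch q a (S n)) eventually
                (locally (L + RtoC 1 : C_NormedModule))).
  { apply filterlim_ext with (fun n => plus (sum_n v n) (RtoC 1 : C_NormedModule)).
    - intros n; rewrite Hsum.
      change (qpoch q a (S n) - 1 + 1 = qpoch q a (S n)); ring.
    - refine (filterlim_comp_2 _ _ _ HL (filterlim_const _) _).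
      apply (filterlim_plus (V := C_NormedModule)). }
  destruct (H P HP) as [N HN].
  exists (S N); intros [| n] Hn; [lia | apply HN; lia]. }
assert (E : qpoch_inf q a = L + 1) by (apply CLim_seq_unique, Hlim).
rewrite E; split; [exact Hlim |].
replace (L + 1 - 1) with L by ring.
exact (is_series_geom_bound v L _ _ Hr HL Hv).
Qed.

Lemma qpoch_S_l (q a : C) (n : nat) :
  qpoch q a (S n) = (1 - a) * qpoch q (a * q) n.
Proof.
induction n as [| n IH]; [simpl; ring |].
change (qpoch q a (S n) * (1 - a * q ^ S n)
        = (1 - a) * (qpoch q (a * q) n * (1 - a * q * q ^ n))).
rewrite IH, Cpow_S; ring.
Qed.

Lemma qpoch_inf_S_l (q a : C) : (Cmod q < 1)%R ->
  qpoch_inf q a = (1 - a) * qpoch_inf q (a * q).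
Proof.
intros Hq; apply CLim_seq_unique; intros P HP.
destruct (filterlim_comp _ _ _ _ _ _ _ _ (proj1 (qpoch_cvg q (a * q) Hq))
  (filterlim_scal_r (V := C_NormedModule) (1 - a) _) P HP) as [N HN].
exists (S N); intros [| n] Hn; [lia |].
rewrite qpoch_S_l; apply HN; lia.
Qed.

Lemma qpoch_inf_1 (q : C) : (Cmod q < 1)%R -> qpoch_inf q 1 = 0.
Proof. intros Hq; rewrite qpoch_inf_S_l by exact Hq; ring. Qed.

Lemma qpoch_q_neq_0 (q : C) (n : nat) : (Cmod q < 1)%R -> qpoch q q n <> 0.
Proof.
intros Hq; induction n as [| n IH].
- exact C1_nz.
- apply Cmult_neq_0; [exact IH |]; intros H.
  assert (E : q ^ S n = 1)
    by (rewrite Cpow_S, <- (Cplus_0_r (q * q ^ n)), <- H; ring).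
  apply (f_equal Cmod) in E; rewrite Cmod_pow, Cmod_1 in E.
  pose proof (Cmod_ge_0 q).
  assert (Cmod q ^ S n < 1)%R by (apply pow_lt_1_compat; [lra | lia]).
  lra.
Qed.

(** * The transform of a power *)

(** The measure of the node [q ^ n] in the transform: the transform of [f] at [w]
is the sum of [qsumudu_weight q n * f (w * q ^ n)]. *)
Definition qsumudu_weight (q : C) (n : nat) : C := q ^ n * qpoch_inf q (q ^ S n).

Lemma Cmod_pow_le_1 (q : C) (n : nat) : (Cmod q < 1)%R -> (Cmod (q ^ n) <= 1)%R.
Proof.
intros Hq; rewrite Cmod_pow, <- (pow1 n).
apply pow_incr; pose proof (Cmod_ge_0 q); lra.
Qed.

(** The tails of the infinite product tend to one geometrically: this gives both
the boundedness of the weights and the limit of their partial sums. *)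
Lemma qpoch_inf_pow_sub_1_le (q : C) : (Cmod q < 1)%R ->
  exists K, (0 <= K)%R /\
    forall n, (Cmod (qpoch_inf q (q ^ S n) - 1) <= K * Cmod q ^ n)%R.
Proof.
intros Hq; pose proof (Cmod_ge_0 q) as Hq0.
assert (Hi : (0 < / (1 - Cmod q))%R) by (apply Rinv_0_lt_compat; lra).
exists (exp (1 / (1 - Cmod q)) * / (1 - Cmod q))%R.
split; [apply Rmult_le_pos; [left; apply exp_pos | lra] |]; intros n.
apply Rle_trans with (1 := proj2 (qpoch_cvg q (q ^ S n) Hq)).
pose proof (Cmod_pow_le_1 q (S n) Hq) as H1.
pose proof (Cmod_ge_0 (q ^ S n)) as H0.
assert (H2 : (Cmod (q ^ S n) <= Cmod q ^ n)%R).
{ rewrite Cmod_pow; simpl.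
  rewrite <- (Rmult_1_l (Cmod q ^ n)) at 2.
  apply Rmult_le_compat_r; [apply pow_le, Hq0 | lra]. }
assert (He : (exp (Cmod (q ^ S n) / (1 - Cmod q)) <= exp (1 / (1 - Cmod q)))%R).
{ apply exp_le; unfold Rdiv; apply Rmult_le_compat_r; lra. }
pose proof (exp_pos (Cmod (q ^ S n) / (1 - Cmod q))).
set (e := exp (Cmod (q ^ S n) / (1 - Cmod q))) in *.
replace (e * Cmod (q ^ S n) / (1 - Cmod q))%R
  with (e * / (1 - Cmod q) * Cmod (q ^ S n))%R by (unfold Rdiv; ring).
apply Rmult_le_compat; [| exact H0 | | exact H2].
- apply Rmult_le_pos; lra.
- apply Rmult_le_compat_r; lra.
Qed.

Lemma qsumudu_weight_le (q : C) : (Cmod q < 1)%R ->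
  exists K, (0 <= K)%R /\ forall n, (Cmod (qsumudu_weight q n) <= K * Cmod q ^ n)%R.
Proof.
intros Hq; pose proof (Cmod_ge_0 q) as Hq0.
destruct (qpoch_inf_pow_sub_1_le q Hq) as [K [HK H]].
exists (K + 1)%R; split; [lra |]; intros n.
unfold qsumudu_weight; rewrite Cmod_mult, Cmod_pow, Rmult_comm.
apply Rmult_le_compat_r; [apply pow_le, Hq0 |].
replace (qpoch_inf q (q ^ S n)) with (qpoch_inf q (q ^ S n) - 1 + 1) by ring.
apply Rle_trans with (1 := Cmod_triangle _ _); rewrite Cmod_1.
apply Rplus_le_compat_r, Rle_trans with (1 := H n).
rewrite <- (Rmult_1_r K) at 2; apply Rmult_le_compat_l; [exact HK |].
rewrite <- Cmod_pow; apply Cmod_pow_le_1, Hq.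
Qed.

(** The transform multiplies the power of degree [l] by [(q;q)_l].  For [l = 0]
the weights telescope, as [q ^ n (q ^ (n + 1);q)_oo] is
[(q ^ (n + 1);q)_oo - (q ^ n;q)_oo] and [(1;q)_oo = 0].  From [l] to [l + 1], the
terms decrease by [u n = q ^ (n (l + 1)) (q ^ n;q)_oo]; since [u 0 = 0] and
[u (n + 1)] is [q ^ (l + 1)] times the old term, the sum is multiplied by
[1 - q ^ (l + 1)]. *)
Lemma is_series_qsumudu_pow (q : C) (l : nat) : (Cmod q < 1)%R ->
  is_series (fun n => qsumudu_weight q n * q ^ (n * l)) (qpoch q q l).
Proof.
intros Hq; pose proof (Cmod_ge_0 q) as Hq0; induction l as [| l IH].
- assert (Hs : forall m, sum_n (fun n => qsumudu_weight q n * q ^ (n * 0)) m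
                         = qpoch_inf q (q ^ S m)).
  { assert (Hd : forall n, qsumudu_weight q n * q ^ (n * 0)
      = qpoch_inf q (q ^ S n) - qpoch_inf q (q ^ n)).
    { intros n; unfold qsumudu_weight.
      rewrite (qpoch_inf_S_l q (q ^ n)), Nat.mul_0_r by exact Hq.
      rewrite (Cmult_comm (q ^ n) q), <- Cpow_S.
      change (q ^ 0) with (RtoC 1); ring. }
    induction m as [| m IH].
    - rewrite sum_O, Hd; change (q ^ 0) with (RtoC 1).
      rewrite qpoch_inf_1 by exact Hq.
      change (qpoch_inf q (q ^ 1) - 0 = qpoch_inf q (q ^ 1)); ring.
    - rewrite sum_Sn, IH, Hd.
      change (qpoch_inf q (q ^ S m) + (qpoch_inf q (q ^ S (S m)) - qpoch_inf q (q ^ S m))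
              = qpoch_inf q (q ^ S (S m))); ring. }
  destruct (qpoch_inf_pow_sub_1_le q Hq) as [K [_ HK]].
  apply filterlim_geom_bound with (K := K) (r := Cmod q); [lra |].
  intros m; rewrite Hs; apply HK.
- set (u n := q ^ (n * S l) * qpoch_inf q (q ^ n)).
  assert (Hu : is_series u (q ^ S l * qpoch q q l)).
  { apply is_series_decr_1.
    change (is_series (fun n => u (S n)) (q ^ S l * qpoch q q l - u O)).
    assert (Hu0 : u O = 0).
    { unfold u; change (q ^ (0 * S l)) with (RtoC 1); change (q ^ 0) with (RtoC 1).
      rewrite qpoch_inf_1 by exact Hq; ring. }
    rewrite Hu0; unfold Cminus; rewrite Copp_0, Cplus_0_r.
    apply is_series_ext with (2 := is_series_scal (q ^ S l) _ _ IH).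
    intros n.
    change (q ^ S l * (qsumudu_weight q n * q ^ (n * l)) = u (S n)).
    unfold u, qsumudu_weight.
    replace (S n * S l)%nat with (S l + n + n * l)%nat by lia.
    rewrite !Cpow_add_r; ring. }
  replace (qpoch q q (S l)) with (qpoch q q l - q ^ S l * qpoch q q l)
    by (simpl qpoch; rewrite Cpow_S; ring).
  apply is_series_ext with (2 := is_series_minus _ _ _ _ IH Hu).
  intros n.
  change (qsumudu_weight q n * q ^ (n * l) - u n
          = qsumudu_weight q n * q ^ (n * S l)).
  unfold u, qsumudu_weight; rewrite (qpoch_inf_S_l q (q ^ n)) by exact Hq.
  replace (n * S l)%nat with (n + n * l)%nat by lia.
  rewrite (Cmult_comm (q ^ n) q), <- Cpow_S, Cpow_add_r; ring.
Qed.

(** The terms of column [l] are bounded by a geometric sequence of ratio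
[|q| ^ (l + 1)], so the tail after row [m] is of order
[|q| ^ ((l + 1) (m + 1))]; the exponent is at least [m + l]. *)
Lemma qsumudu_pow_tail_le (q : C) : (Cmod q < 1)%R ->
  exists K, forall l m,
    (Cmod (qpoch q q l - sum_n (fun n => (qsumudu_weight q n * q ^ (n * l))%C) m)
     <= K * Cmod q ^ m * Cmod q ^ l)%R.
Proof.
intros Hq; pose proof (Cmod_ge_0 q) as Hq0.
destruct (qsumudu_weight_le q Hq) as [K [HK Hw]].
exists (K / (1 - Cmod q))%R; intros l m.
assert (Hle : forall i j, (i <= j)%nat -> (Cmod q ^ j <= Cmod q ^ i)%R).
{ intros i j Hij; replace j with (i + (j - i))%nat by lia.
  rewrite pow_add; rewrite <- (Rmult_1_r (Cmod q ^ i)) at 2.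
  apply Rmult_le_compat_l; [apply pow_le, Hq0 |].
  rewrite <- Cmod_pow; apply Cmod_pow_le_1, Hq. }
assert (Hr : (0 <= Cmod q ^ S l <= Cmod q)%R).
{ split; [apply pow_le, Hq0 |].
  rewrite <- (pow_1 (Cmod q)) at 2; apply Hle; lia. }
eapply Rle_trans.
- apply is_series_tail_geom_bound with (K := K) (r := (Cmod q ^ S l)%R);
    [lra | apply is_series_qsumudu_pow, Hq |].
  intros n; rewrite Cmod_mult, Cmod_pow, <- pow_mult.
  replace (S l * n)%nat with (n + n * l)%nat by lia.
  rewrite pow_add, <- Rmult_assoc.
  apply Rmult_le_compat_r; [apply pow_le, Hq0 | apply Hw].
- rewrite <- pow_mult.
  replace (K / (1 - Cmod q) * Cmod q ^ m * Cmod q ^ l)%R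
    with (K * Cmod q ^ (m + l) * / (1 - Cmod q))%R
    by (rewrite pow_add; unfold Rdiv; ring).
  unfold Rdiv; apply Rmult_le_compat.
  + apply Rmult_le_pos; [exact HK | apply pow_le, Hq0].
  + left; apply Rinv_0_lt_compat; lra.
  + apply Rmult_le_compat_l; [exact HK | apply Hle; lia].
  + apply Rinv_le_contravar; lra.
Qed.

(** * Exchange of the transform with a power series *)

(** For [n = 0] the series is that of [d]; for positive [n] it converges
absolutely, because [d] is bounded. *)
Lemma ex_series_geom_dilation (d : nat -> C) (q : C) (n : nat) :
  (Cmod q < 1)%R -> ex_series d -> ex_series (fun l => d l * q ^ (n * l)).
Proof.
intros Hq Hd; pose proof (Cmod_ge_0 q) as Hq0; destruct n as [| n].
- apply ex_series_ext with (2 := Hd).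
  intros l; change (d l = d l * 1); ring.
- destruct (ex_series_terms_bounded d Hd) as [B [HB0 HB]].
  apply ex_series_geom_bound with (K := B) (r := Cmod q); [lra |].
  intros l; rewrite Cmod_mult, Cmod_pow.
  replace (S n * l)%nat with (n * l + l)%nat by lia.
  rewrite pow_add.
  apply Rmult_le_compat; auto using Cmod_ge_0.
  + apply Rmult_le_pos; apply pow_le, Hq0.
  + rewrite <- (Rmult_1_l (Cmod q ^ l)) at 2.
    apply Rmult_le_compat_r; [apply pow_le, Hq0 |].
    rewrite <- Cmod_pow; apply Cmod_pow_le_1, Hq.
Qed.

Lemma is_series_qsumudu_swap (d : nat -> C) (q : C) :
  (Cmod q < 1)%R -> ex_series d ->
  exists M : C, is_series (fun l => d l * qpoch q q l) M /\
    is_series (fun n => qsumudu_weight q n * CSeries (fun l => d l * q ^ (n * l))) M.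
Proof.
intros Hq Hd; pose proof (Cmod_ge_0 q) as Hq0.
destruct (qsumudu_pow_tail_le q Hq) as [K HK].
apply is_series_swap with (h := fun n l => qsumudu_weight q n * q ^ (n * l))
  (K := K) (r := Cmod q); [lra | exact Hd | | exact HK].
intros n; destruct (ex_series_geom_dilation d q n Hq Hd) as [f Hf].
rewrite (CSeries_unique _ _ Hf).
apply is_series_ext with (2 := is_series_scal (qsumudu_weight q n) _ _ Hf).
intros l.
change (qsumudu_weight q n * (d l * q ^ (n * l)) = d l * (qsumudu_weight q n * q ^ (n * l))).
ring.
Qed.

Lemma qR_term_mult_pow (q lq l1q : C) (a b : list C) (alpha beta z c : C) (l : nat) :
  qR_term q lq l1q a b alpha beta (z * c) l
  = qR_term q lq l1q a b alpha beta z l * c ^ l.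
Proof. unfold qR_term, qM_term, Cdiv; rewrite Cpow_mult_l; ring. Qed.

Theorem theorem14 (q lq l1q : C)
  (hq0 : (0 < Cmod q)%R) (hq1 : (Cmod q < 1)%R)
  (hlq : Cexp lq = q) (hl1q : Cexp l1q = 1 - q)
  (r s : nat) (hr : (1 <= r)%nat) (hs : (1 <= s)%nat)
  (a b : list C) (ha : length a = r) (hb : length b = s)
  (ha1 : forall (ai : C) (l : nat), In ai a -> ai * q ^ l <> 1)
  (hb1 : forall (bj : C) (l : nat), In bj b -> bj * q ^ l <> 1)
  (alpha beta z w : C)
  (hR : ex_series (qR_term q lq l1q a b alpha beta (z * w))) :
  ex_qsumudu q (fun t => qR q lq l1q a b alpha beta (z * t)) w /\
  ex_series (qM_term q lq l1q a b alpha beta (z * w)) /\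
  qsumudu q (fun t => qR q lq l1q a b alpha beta (z * t)) w
  = qM q lq l1q a b alpha beta (z * w).
Proof.
destruct (is_series_qsumudu_swap _ q hq1 hR) as [M [HM HJ]].
assert (HM' : is_series (qM_term q lq l1q a b alpha beta (z * w)) M).
{ apply is_series_ext with (2 := HM).
  intros l; unfold qR_term.
  set (c := qM_term q lq l1q a b alpha beta (z * w) l).
  change (c / qpoch q q l * qpoch q q l = c).
  field; apply qpoch_q_neq_0, hq1. }
assert (HJ' : is_series (jackson_term q 1 (qsumudu_integrand q
    (fun t => qR q lq l1q a b alpha beta (z * t)) w)) M).
{ apply is_series_ext with (2 := HJ).
  intros n; unfold jackson_term, qsumudu_integrand, qsumudu_weight, qR.
  rewrite Cmult_1_l, <- Cpow_S, (Cmult_assoc z w (q ^ n)).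
  rewrite (Cmult_comm (CSeries _) (qpoch_inf _ _)).
  replace (qR_term q lq l1q a b alpha beta (z * w * q ^ n))
    with (fun l => qR_term q lq l1q a b alpha beta (z * w) l * q ^ (n * l)).
  - symmetry; apply Cmult_assoc.
  - apply functional_extensionality; intros l.
    rewrite (qR_term_mult_pow _ _ _ _ _ _ _ (z * w)), Cpow_mult_r.
    reflexivity. }
assert (H1q : 1 - q <> 0).
{ replace (1 - q) with (qpoch q q 1) by (simpl; ring).
  apply qpoch_q_neq_0, hq1. }
split; [exists M; exact HJ' |]; split; [exists M; exact HM' |].
unfold qsumudu, jackson, qM.
rewrite (CSeries_unique _ _ HM'), (CSeries_unique _ _ HJ').
field; exact H1q.
Qed.
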